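(* Let $d\ge 4$ be an integer and let $0<p<2<q<\infty$. Then the following hold. (1) If $0<p\le 1$, then \[ \min \left\{\frac{\|x\|_p}{\|x\|_2}:\ 0\neq x\in\mathbb R^d,\ \sum_{i=1}^d x_i=0\right\}=2^{1/p-1/2}. \] (2) If $1<p<2$, then \[ \min \left\{\frac{\|x\|_p}{\|x\|_2}:\ 0\neq x\in\mathbb R^d,\ \sum_{i=1}^d x_i=0\right\} =\min\left\{2^{1/p-1/2},\ \left(\frac{(d-1)^{p/2}+(d-1)^{1-p/2}}{d^{p/2}}\right)^{1/p}\right\}. \] (3) For $2<q<\infty$, \[ \max\left\{\frac{\|x\|_q}{\|x\|_2}:\ 0\neq x\in\mathbb R^d,\ \sum_{i=1}^d x_i=0\right\} =\max\left\{2^{1/q-1/2},\ \left(\frac{(d-1)^{q/2}+(d-1)^{1-q/2}}{d^{q/2}}\right)^{1/q}\right\}. \]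
   Context: For $x=(x_1,\dots,x_d)\in\mathbb R^d$ and $p>0$, $\|x\|_p:=\left(\sum_{i=1}^d|x_i|^p\right)^{1/p}$ denotes the $\ell_p$ (quasi-)norm. The minima and maxima are asserted to be attained. *)

(* Defs.v *)
From HB Require Import structures.
From mathcomp Require Import all_boot all_order all_algebra.
From mathcomp Require Import classical_sets reals exp.

Set Implicit Arguments.
Unset Strict Implicit.
Unset Printing Implicit Defensive.

Import Order.TTheory GRing.Theory Num.Theory.
Local Open Scope classical_set_scope.
Local Open Scope ring_scope.

(* Meaningful for p > 0 only: [powR] satisfies 0 `^ p = 0 for p != 0, but
   0 `^ 0 = 1. *)
Definition lpnorm (R : realType) (d : nat) (p : R) (x : 'rV[R]_d) : R :=
  (\sum_(i < d) `|x 0 i| `^ p) `^ p^-1.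

Definition zero_sum_ratios (R : realType) (d : nat) (p : R) : set R :=
  [set lpnorm p x / lpnorm 2 x |
    x in [set x : 'rV[R]_d | x != 0 /\ \sum_(i < d) x 0 i = 0]].

Definition is_min (R : realType) (A : set R) (m : R) : Prop :=
  A m /\ lbound A m.

Definition is_max (R : realType) (A : set R) (m : R) : Prop :=
  A m /\ ubound A m.

(* Main.v *)
Require Import Defs.
From HB Require Import structures.
From mathcomp Require Import all_boot all_order all_algebra.
From mathcomp Require Import ring lra zify.
From mathcomp Require Import boolp classical_sets interval_inference.
From mathcomp Require Import reals topology normedtype derive realfun exp.

Set Implicit Arguments.
Unset Strict Implicit.
Unset Printing Implicit Defensive.

Import Order.TTheory GRing.Theory Num.Theory numFieldNormedType.Exports.
Local Open Scope classical_set_scope.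
Local Open Scope ring_scope.

(** For 0 < p <= 1 a tangent line suffices. With m = ||x||_2 / sqrt 2 one has
    |t|^p >= (2 - p) m^(p-1) |t| - (1 - p) m^(p-2) t^2, with equality at t = 0
    and |t| = m, the values taken by the minimiser (1, -1, 0, ..., 0). Summing
    over the coordinates ([psum_ge_le1]), only ||x||_1 >= sqrt 2 ||x||_2 is
    needed, which holds because no coordinate of a zero-sum vector exceeds
    half of the l_1 norm ([sqsum_le_l1]).

    Every exponent q > 1 other than 2 is treated at once, by maximising
    (q - 2) sum |x_i|^q: this is a maximum of the q-norm for q > 2 and a
    minimum for q < 2. By compactness a maximiser x exists on the zero-sum unit
    sphere ([extremal_exists]); let C be its value of sum |x_i|^q.

    - Shape of x ([extremal_shape]). Moving two coordinates in opposite
      directions gives, to first order, that sgn(t) |t|^(q-1) - C t has the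
      same value at all coordinates ([tilt_eq]) and, to second order, that a
      value taken twice lies in the middle zone where this function of t is
      injective ([repeated_coord], [tilt_inner_neq]). Each of the two outer
      zones also carries at most one value ([tilt_outer]). Hence all
      coordinates other than a largest and a smallest one are equal.
    - Up to symmetry and scaling, x = (1 + k s, -s, ..., -s, -(1 - k s)) with
      k = (d - 2) / 2 >= 1 and 0 <= s <= 1 / (k + 1) ([arc_ratio_cover]). The
      ends s = 0 and s = 1 / (k + 1) are (1, 0, ..., 0, -1) and a multiple of
      (d - 1, -1, ..., -1), the two competitors in the theorem.
    - One variable remains, and the extremum over s is at an end
      ([arc_ratio_le_ends]). For q >= 3 the ratio is monotone in s
      ([arc_slope_ge0]). For 1 < q < 3 the normalised derivative, written in
      the variable c = 1/s, is quasiconcave and vanishes at the end c = k + 1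
      ([arc_slope_inv_quasiconcave]); so, as s grows, q - 2 times the
      ratio first decreases and then increases. Behind this is the
      monotonicity of r tanh u / tanh (r u) for |r| < 1
      ([coth_ratio_decr]). *)

(** * Calculus on the line *)

(* The sum rule in applied form, so that instance resolution can split a sum
   under a lambda. *)
#[local] Instance is_derive_pwD (R : realType) (f g : R -> R) (x df dg : R) :
  is_derive x 1 f df -> is_derive x 1 g dg ->
  is_derive x 1 (fun y => f y + g y) (df + dg).
Proof. by move=> *; exact: is_deriveD. Qed.

Section Scalar.
Variable R : realType.
Implicit Types (a b c p q r s t u v x y C M k : R).

Lemma mean_value (f df : R -> R) a b : a < b ->
  (forall x, a <= x <= b -> is_derive x 1 f (df x)) ->
  exists2 c, a < c < b & f b - f a = df c * (b - a).
Proof.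
move=> ab dfP.
have cf : {within `[a, b], continuous f}.
  apply: derivable_within_continuous => x; rewrite in_itv/= => xab.
  by have [] := dfP _ xab.
have [|c cab E] := @MVT _ f df _ _ ab _ cf.
  move=> x; rewrite in_itv/= => /andP[ax xb].
  by apply: dfP; rewrite !ltW.
by exists c => //; move: cab; rewrite in_itv.
Qed.

Lemma derive_ge0_le (f df : R -> R) a b : a <= b ->
  (forall x, a <= x <= b -> is_derive x 1 f (df x)) ->
  (forall x, a < x < b -> 0 <= df x) -> f a <= f b.
Proof.
rewrite le_eqVlt => /predU1P[<-//|ab] dfP df0.
have [c cab E] := mean_value ab dfP.
by rewrite -subr_ge0 E mulr_ge0 ?df0// subr_ge0 ltW.
Qed.

Lemma derive_le0_ge (f df : R -> R) a b : a <= b ->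
  (forall x, a <= x <= b -> is_derive x 1 f (df x)) ->
  (forall x, a < x < b -> df x <= 0) -> f b <= f a.
Proof.
rewrite le_eqVlt => /predU1P[<-//|ab] dfP df0.
have [c cab E] := mean_value ab dfP.
by rewrite -subr_ge0 -opprB E -mulNr mulr_ge0 ?oppr_ge0 ?df0// subr_ge0 ltW.
Qed.

Lemma powR_mean_value p a b : 0 < a -> a < b ->
  exists2 c, a < c < b & b `^ p - a `^ p = p * c `^ (p - 1) * (b - a).
Proof.
move=> a0 ab; apply: (@mean_value (fun x => x `^ p) _ _ _ ab) => x /andP[ax _].
exact/is_derive1_powR/(lt_le_trans a0).
Qed.

(** The signed power, which up to the factor p + 1 is the derivative of
    |t|^(p+1). *)
Definition spow p t : R := Num.sg t * `|t| `^ p.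

Lemma spow_pos p t : 0 <= t -> p != 0 -> spow p t = t `^ p.
Proof.
rewrite /spow le_eqVlt => /predU1P[<- p0|t0 _].
  by rewrite sgr0 mul0r powR0.
by rewrite gtr0_sg// mul1r gtr0_norm.
Qed.

Lemma spowN p t : spow p (- t) = - spow p t.
Proof. by rewrite /spow sgrN normrN mulNr. Qed.

Lemma cvg_abspow0 p : 0 < p -> `|t| `^ p @[t --> (0:R)] --> (0:R).
Proof.
move=> p0; apply/cvgrPdist_lt => e e0; near=> t.
rewrite sub0r normrN norm_powR// normr_id.
have -> : e = (e `^ p^-1) `^ p.
  by rewrite -powRrM mulVf ?gt_eqF// powRr1// ltW.
rewrite gt0_ltr_powR ?nnegrE ?powR_ge0//.
near: t; have E := @nbhs0_lt R R _ (powR_gt0 p^-1 e0); exact: E.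
Unshelve. all: by end_near. Qed.

(** Away from 0 this is the rule for powers; at 0 the difference quotient is
    spow (q - 1) itself, which tends to 0 because q > 1. *)
Lemma is_derive_abspow q t : 1 < q ->
  is_derive t 1 (fun x => `|x| `^ q) (q * spow (q - 1) t).
Proof.
move=> q1; have q10 : 0 < q - 1 by rewrite subr_gt0.
have [t0|t0|->] := ltgtP t 0.
- rewrite -[t]opprK spowN mulrN -mulrN1.
  rewrite spow_pos ?oppr_ge0 ?(ltW t0) ?gt_eqF// opprK.
  have H : is_derive t 1 ((fun x => x `^ q) \o -%R) (q * (- t) `^ (q - 1) * - 1).
    apply: is_derive1_comp; apply: is_derive1_powR; by rewrite oppr_gt0.
  apply: near_eq_is_derive H.
  near=> x => /=; rewrite ltr0_norm//; near: x; exact: lt_nbhsl.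
- rewrite spow_pos ?(ltW t0) ?gt_eqF//.
  have H : is_derive t 1 (fun x => x `^ q) (q * t `^ (q - 1)).
    exact: is_derive1_powR.
  apply: near_eq_is_derive H.
  near=> x => /=; rewrite gtr0_norm//; near: x; exact: lt_nbhsr.
- have -> : q * spow (q - 1) 0 = 0 by rewrite /spow sgr0 mul0r mulr0.
  apply/is_derive1_caratheodory; exists (spow (q - 1)); split.
  + move=> z; rewrite normr0 powR0 ?gt_eqF ?(lt_trans _ q1)// !subr0.
    have [->|z0] := eqVneq z 0.
      by rewrite normr0 powR0 ?gt_eqF ?(lt_trans _ q1)// mulr0.
    rewrite -(@mulr_powRB1 _ `|z| q)// ?(lt_trans _ q1)//.
    by rewrite /spow {1}normrEsg; ring.
  + have s0 : spow (q - 1) 0 = 0 by rewrite /spow sgr0 mul0r.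
    rewrite /prop_for /continuous_at /= s0; apply/norm_cvg0P.
    apply: cvg_trans (cvg_abspow0 q10).
    apply: near_eq_cvg; near=> z.
    rewrite /spow normrM norm_powR// normr_id.
    have [->|z0] := eqVneq z 0; first by rewrite normr0 powR0 ?mulr0 ?gt_eqF.
    by rewrite normr_sg z0 mul1r.
  + by rewrite /spow sgr0 mul0r.
Unshelve. all: by end_near. Qed.

(** * Coordinates of an extremal vector *)

Lemma is_derive_gt0_right (f : R -> R) l : is_derive (0:R) 1 f l -> 0 < l ->
  exists2 e, 0 < e & forall x, 0 < x < e -> f 0 < f x.
Proof.
move=> /is_derive1_caratheodory[g [fE gC <-]] g0.
have /nbhs_ballP[e /= e0 eP] : \forall z \near (0:R), 0 < g z.
  exact: (cvgr_gt (g 0) gC).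
exists e => // x /andP[x0 xe].
have gx0 : 0 < g x by apply: eP; rewrite /ball/= sub0r normrN gtr0_norm.
by rewrite -subr_gt0 fE subr0 mulr_gt0.
Qed.

Lemma max_derive_eq0 (f : R -> R) l : is_derive (0:R) 1 f l ->
  (forall x, f x <= f 0) -> l = 0.
Proof.
have le0 (g : R -> R) m : is_derive (0:R) 1 g m -> (forall x, g x <= g 0) -> m <= 0.
  move=> gm gmax; rewrite leNgt; apply/negP => m0.
  have [e e0 eP] := is_derive_gt0_right gm m0.
  have /eP : 0 < e / 2 < e by lra.
  by rewrite ltNge gmax.
move=> fl fmax; apply/eqP; rewrite eq_le (le0 _ _ fl)//= -oppr_le0.
apply: (le0 (f \o -%R)) => [|x /=]; last by rewrite oppr0.
rewrite -mulrN1; apply: is_derive1_comp; rewrite oppr0; exact: fl.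
Qed.

Lemma max_derive2_le0 (f f1 : R -> R) l :
  (forall x, is_derive x 1 f (f1 x)) -> f1 0 = 0 -> is_derive (0:R) 1 f1 l ->
  (forall x, f x <= f 0) -> l <= 0.
Proof.
move=> ff1 f10 f1l fmax; rewrite leNgt; apply/negP => l0.
have [e e0 eP] := is_derive_gt0_right f1l l0.
have e20 : 0 < e / 2 by lra.
have [c /andP[c0 ce] E] := mean_value e20 (fun x _ => ff1 x).
have : 0 < f1 c by rewrite -f10; apply: eP; rewrite c0/=; lra.
move=> f1c; have := fmax (e / 2); rewrite -subr_le0 E subr0 leNgt.
by rewrite mulr_gt0.
Qed.

(** Up to the factor q, the partial derivative of sum |x_i|^q - C ||x||_2^q on
    the unit sphere; its value at all coordinates of an extremal vector is the
    Lagrange multiplier of the constraint sum x_i = 0. *)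
Definition tilt q C t : R := spow (q - 1) t - C * t.

Lemma is_derive_spow p t : 0 < t -> p != 0 ->
  is_derive t 1 (spow p) (p * t `^ (p - 1)).
Proof.
move=> t0 p0; have := is_derive1_powR p t0.
apply: near_eq_is_derive; near=> x.
by rewrite spow_pos// ltW//; near: x; exact: lt_nbhsr.
Unshelve. all: by end_near. Qed.

(** First-order condition. The perturbation a + e, b - e keeps the sum and
    changes the squared norm from 1 to 1 + 2 e (a - b) + 2 e^2. Using the
    homogeneous form C ||.||_2^q avoids having to stay on the sphere. *)
Lemma tilt_eq q C a b : 1 < q -> q != 2 ->
  (forall e, (q - 2) * (`|a + e| `^ q + `|b - e| `^ q
               - C * (1 + 2 * e * (a - b) + 2 * e ^+ 2) `^ (q / 2))
             <= (q - 2) * (`|a| `^ q + `|b| `^ q - C)) ->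
  tilt q C a = tilt q C b.
Proof.
move=> q1 q2 H.
pose h e := (q - 2) * (`|a + e| `^ q + `|b - e| `^ q
               - C * (1 + 2 * e * (a - b) + 2 * e ^+ 2) `^ (q / 2)).
have hmax e : h e <= h 0.
  have -> : h 0 = (q - 2) * (`|a| `^ q + `|b| `^ q - C).
    by rewrite /h addr0 subr0 mulr0 mul0r addr0 expr0n/= mulr0 addr0 powR1 mulr1.
  exact: H.
have dh : is_derive (0:R) 1 h ((q - 2) * (q * tilt q C a - q * tilt q C b)).
  have d1 : is_derive (0:R) 1 (fun e => `|a + e| `^ q) (q * spow (q - 1) (a + 0) * 1).
    apply: (@is_derive1_comp R (fun x => `|x| `^ q) (fun e => a + e)).
    - exact: is_derive_abspow.
    - by apply: is_derive_eq; rewrite add0r.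
  have d2 : is_derive (0:R) 1 (fun e => `|b - e| `^ q) (q * spow (q - 1) (b - 0) * - 1).
    apply: (@is_derive1_comp R (fun x => `|x| `^ q) (fun e => b - e)).
    - exact: is_derive_abspow.
    - by apply: is_derive_eq; rewrite add0r.
  pose g e : R := 1 + 2 * e * (a - b) + 2 * e ^+ 2.
  have g0 : g 0 = 1 by rewrite /g; ring.
  have dg : is_derive (0:R) 1 g (2 * (a - b)).
    rewrite /g; apply: is_derive_eq; rewrite /GRing.scale/=; ring.
  have d3 : is_derive (0:R) 1 (fun e => (g e) `^ (q / 2))
      (q / 2 * (g 0) `^ (q / 2 - 1) * (2 * (a - b))).
    apply: (@is_derive1_comp R (fun x => x `^ (q / 2)) g).
    by apply: is_derive1_powR; rewrite g0.
  rewrite /h; apply: is_derive_eq.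
  by rewrite /GRing.scale/= /tilt g0 powR1 subr0 addr0; field.
have /eqP := max_derive_eq0 dh hmax.
rewrite -mulrBr !mulf_eq0 !subr_eq0 (negbTE q2) (gt_eqF (lt_trans ltr01 q1))/=.
by move/eqP.
Qed.

(** Second-order condition for the same perturbation at two equal coordinates,
    where the squared norm changes by 2 e^2 only. The conclusion says that
    (q - 2) (spow (q - 1) t - C t) does not increase at t = a. *)
Lemma repeated_coord q C a : 1 < q -> 0 < a ->
  (forall e, (q - 2) * (`|a + e| `^ q + `|a - e| `^ q
               - C * (1 + 2 * e ^+ 2) `^ (q / 2))
             <= (q - 2) * (`|a| `^ q + `|a| `^ q - C)) ->
  (q - 2) * ((q - 1) * a `^ (q - 2) - C) <= 0.
Proof.
move=> q1 a0 H.
pose h e := (q - 2) * (`|a + e| `^ q + `|a - e| `^ q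
               - C * (1 + 2 * e ^+ 2) `^ (q / 2)).
have hmax e : h e <= h 0.
  have -> : h 0 = (q - 2) * (`|a| `^ q + `|a| `^ q - C).
    by rewrite /h addr0 subr0 expr0n/= mulr0 addr0 powR1 mulr1.
  exact: H.
pose h1 e := (q - 2) * (q * spow (q - 1) (a + e) - q * spow (q - 1) (a - e)
  - C * (2 * q * e * (1 + 2 * e ^+ 2) `^ (q / 2 - 1))).
pose g e : R := 1 + 2 * e ^+ 2.
have g0 x : 0 < g x by rewrite /g; have := sqr_ge0 x; lra.
have dg x : is_derive x 1 g (4 * x).
  rewrite /g; apply: is_derive_eq; rewrite /GRing.scale/=; ring.
have dD (x : R) : is_derive x 1 (fun e => a + e) 1.
  by apply: is_derive_eq; rewrite add0r.
have dB (x : R) : is_derive x 1 (fun e => a - e) (-1).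
  by apply: is_derive_eq; rewrite add0r.
have dgp x p : is_derive x 1 (fun e => (g e) `^ p) (p * (g x) `^ (p - 1) * (4 * x)).
  apply: (@is_derive1_comp R (fun x => x `^ p) g).
  exact: is_derive1_powR.
have dh x : is_derive x 1 h (h1 x).
  have d1 := @is_derive1_comp R (fun x => `|x| `^ q) (fun e => a + e) x _ _
     (is_derive_abspow _ q1) (dD x).
  have d2 := @is_derive1_comp R (fun x => `|x| `^ q) (fun e => a - e) x _ _
     (is_derive_abspow _ q1) (dB x).
  have d3 := dgp x (q / 2).
  rewrite /h; apply: is_derive_eq.
  by rewrite /GRing.scale/= /h1 /g; field.
have q10 : q - 1 != 0 by rewrite subr_eq0 gt_eqF.
have h10 : h1 0 = 0 by rewrite /h1 addr0 subr0; ring.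
have dh1 : is_derive (0:R) 1 h1
    (2 * q * ((q - 2) * ((q - 1) * a `^ (q - 2) - C))).
  have aD : 0 < a + 0 by rewrite addr0.
  have aB : 0 < a - 0 by rewrite subr0.
  have d1 := @is_derive1_comp R (spow (q - 1)) (fun e => a + e) _ _ _
     (is_derive_spow aD q10) (dD 0).
  have d2 := @is_derive1_comp R (spow (q - 1)) (fun e => a - e) _ _ _
     (is_derive_spow aB q10) (dB 0).
  have d3 := dgp 0 (q / 2 - 1).
  rewrite /h1; apply: is_derive_eq.
  have E : q - 1 - 1 = q - 2 by ring.
  have E0 : g 0 = 1 by rewrite /g; ring.
  rewrite /GRing.scale/= E0 !powR1 !addr0 subr0 E.
  have -> : 1 + 2 * 0 ^+ 2 = 1 :> R by ring.
  rewrite powR1; ring.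
have := max_derive2_le0 dh h10 dh1 hmax.
by rewrite pmulr_rle0//; lra.
Qed.

(** The factor r makes the monotonicity of x^r independent of the sign of r. *)
Lemma ltr_powR_scaled r x y : r != 0 -> 0 < x -> x < y ->
  r * x `^ r < r * y `^ r.
Proof.
move=> r0 x0 xy; have y0 := lt_trans x0 xy.
have [rneg|rpos|/eqP] := ltgtP r 0; last by rewrite (negbTE r0).
  rewrite ltr_nM2l// -[r]opprK !(powRN _ (- r)) ltf_pV2 ?posrE ?powR_gt0//.
  by rewrite gt0_ltr_powR ?nnegrE ?oppr_gt0// ltW.
by rewrite ltr_pM2l// gt0_ltr_powR ?nnegrE// ltW.
Qed.

(** By the mean value theorem C is (q - 1) c^(q - 2) for some c > b, so b is on
    the inner side of the point where the derivative of [tilt] vanishes. *)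
Lemma tilt_outer q C a b : 1 < q -> q != 2 -> 0 < b -> b < a ->
  tilt q C a = tilt q C b -> 0 < (q - 2) * (C - (q - 1) * b `^ (q - 2)).
Proof.
move=> q1 q2 b0 ba; rewrite /tilt.
have a0 := lt_trans b0 ba.
have q10 : q - 1 != 0 by rewrite subr_eq0 gt_eqF.
rewrite !spow_pos ?ltW// => E.
have [c /andP[bc _]] := powR_mean_value (q - 1) b0 ba.
have -> : q - 1 - 1 = q - 2 by ring.
move=> Ec; have CE : C = (q - 1) * c `^ (q - 2).
  have : (C - (q - 1) * c `^ (q - 2)) * (a - b) = 0 by rewrite mulrBl -Ec; lra.
  by move/eqP; rewrite mulf_eq0 !subr_eq0 (gt_eqF ba) orbF => /eqP.
rewrite CE -mulrBr mulrCA mulr_gt0 ?subr_gt0// mulrBr subr_gt0.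
by rewrite ltr_powR_scaled// subr_eq0.
Qed.

(** Two distinct values in the middle zone, where (q - 2) tilt is decreasing on
    each side of 0, are separated by [tilt]. If b < 0 < a the two values of
    (q - 2) tilt have opposite strict signs; if b > 0 the mean value theorem
    contradicts the condition on a. *)
Lemma tilt_inner_neq q C a b : 1 < q -> q != 2 -> b < a -> 0 < a ->
  (q - 2) * ((q - 1) * a `^ (q - 2) - C) <= 0 ->
  (b < 0 -> (q - 2) * ((q - 1) * (- b) `^ (q - 2) - C) <= 0) ->
  tilt q C a != tilt q C b.
Proof.
move=> q1 q2 ba a0 ina inb; apply/negP => /eqP E.
have q20 : q - 2 != 0 by rewrite subr_eq0.
have q10 : q - 1 != 0 by rewrite subr_eq0 gt_eqF.
have below x : 0 < x -> (q - 2) * ((q - 1) * x `^ (q - 2) - C) <= 0 ->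
    (q - 2) * (x `^ (q - 1) - C * x) < 0.
  move=> x0 inx; rewrite -mulr_powRB1 ?ltW ?subr_gt0//.
  have -> : q - 1 - 1 = q - 2 by ring.
  have -> : (q - 2) * (x * x `^ (q - 2) - C * x) =
    x * ((q - 2) * ((q - 1) * x `^ (q - 2) - C) - (q - 2) ^+ 2 * x `^ (q - 2)).
    ring.
  rewrite pmulr_rlt0//; suff : 0 < (q - 2) ^+ 2 * x `^ (q - 2) by lra.
  by rewrite mulr_gt0 ?powR_gt0// exprn_even_gt0.
have := below _ a0 ina; move: E; rewrite /tilt [X in X - _ = _]spow_pos ?ltW//.
have [b0|b0|->] := ltgtP b 0.
- have nb0 : 0 < - b by rewrite oppr_gt0.
  have := below _ nb0 (inb b0).
  rewrite -[b in spow _ b]opprK spowN spow_pos ?ltW// => Hb E.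
  by rewrite E => Ha; move: Hb Ha; nra.
- rewrite spow_pos ?ltW// => E _.
  have [c /andP[bc ca]] := powR_mean_value (q - 1) b0 ba.
  have -> : q - 1 - 1 = q - 2 by ring.
  move=> Ec; have CE : C = (q - 1) * c `^ (q - 2).
    have : (C - (q - 1) * c `^ (q - 2)) * (a - b) = 0 by rewrite mulrBl -Ec; lra.
    by move/eqP; rewrite mulf_eq0 !subr_eq0 (gt_eqF ba) orbF => /eqP.
  move: ina; rewrite CE -mulrBr mulrCA pmulr_rle0 ?subr_gt0// mulrBr.
  rewrite subr_le0 leNgt => /negP; apply.
  by apply: ltr_powR_scaled => //; exact: lt_trans bc.
- by rewrite /spow sgr0 !mul0r mulr0 => ->; rewrite subrr mulr0 ltxx.
Qed.

(** * The arc between the two extremal configurations *)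

Lemma mulr_powRB1_gt0 x p : 0 < x -> x * x `^ (p - 1) = x `^ p.
Proof.
move=> x0; rewrite powRB ?(gt_eqF x0) ?implybT// powRr1 ?(ltW x0)//.
by rewrite mulrC divfK// gt_eqF.
Qed.

(** The ratio ||x||_q^q / ||x||_2^q of x = (1 + k s, -s, ..., -s, -(1 - k s)),
    with 2 k middle coordinates. *)
Definition arc_ratio q k s : R :=
  (`|1 + k * s| `^ q + `|1 - k * s| `^ q + 2 * k * `|s| `^ q)
  * (2 + 2 * k * (k + 1) * s ^+ 2) `^ (- (q / 2)).

(** The derivative of [arc_ratio] in s, up to a nonnegative factor. *)
Definition arc_slope q k s : R :=
  (1 + k * s) `^ (q - 1) * (1 - (k + 1) * s)
  - (1 - k * s) `^ (q - 1) * (1 + (k + 1) * s) + 2 * s `^ (q - 1).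

Lemma is_derive_arc_ratio q k s : 1 < q -> 1 <= k -> 0 <= s <= (k + 1)^-1 ->
  is_derive s 1 (arc_ratio q k)
    (2 * q * k * (2 + 2 * k * (k + 1) * s ^+ 2) `^ (- (q / 2) - 1)
     * arc_slope q k s).
Proof.
move=> q1 k1 /andP[s0 s1].
have k0 : 0 < k + 1 by lra.
have ks1 : (k + 1) * s <= 1 by rewrite mulrC -ler_pdivlMr// div1r.
have q10 : q - 1 != 0 by rewrite subr_eq0 gt_eqF.
have aD : 0 <= 1 + k * s by nra.
have aB : 0 <= 1 - k * s by nra.
pose g x : R := 2 + 2 * k * (k + 1) * x ^+ 2.
have g0 : 0 < g s by rewrite /g; have := sqr_ge0 s; nra.
have dg : is_derive s 1 g (4 * k * (k + 1) * s).
  by rewrite /g; apply: is_derive_eq; rewrite /GRing.scale/=; ring.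
have dD : is_derive s 1 (fun x => 1 + k * x) k.
  by apply: is_derive_eq; rewrite /GRing.scale/=; ring.
have dB : is_derive s 1 (fun x => 1 - k * x) (- k).
  by apply: is_derive_eq; rewrite /GRing.scale/=; ring.
have d1 := @is_derive1_comp R (fun x => `|x| `^ q) (fun x => 1 + k * x) _ _ _
   (is_derive_abspow _ q1) dD.
have d2 := @is_derive1_comp R (fun x => `|x| `^ q) (fun x => 1 - k * x) _ _ _
   (is_derive_abspow _ q1) dB.
have d3 := is_derive_abspow s q1.
have d4 : is_derive s 1 (fun x => (g x) `^ (- (q / 2)))
    (- (q / 2) * (g s) `^ (- (q / 2) - 1) * (4 * k * (k + 1) * s)).
  apply: (@is_derive1_comp R (fun x => x `^ (- (q / 2))) g).
  exact: is_derive1_powR.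
rewrite /arc_ratio; apply: is_derive_eq.
rewrite /GRing.scale/= !spow_pos// !ger0_norm//.
rewrite -!(@mulr_powRB1 _ _ q) ?(lt_trans _ q1)//.
have -> : (2 + 2 * k * (k + 1) * s ^+ 2) `^ (- (q / 2)) =
   (g s) * (g s) `^ (- (q / 2) - 1).
  by rewrite mulr_powRB1_gt0.
by rewrite /arc_slope /g; field.
Qed.

(** A convex function, here x^r with r <= 0 or r >= 1, lies above its
    tangents. *)
Lemma powR_tangent r x b : 0 <= r * (r - 1) -> 0 < b -> 0 < x ->
  r * b `^ (r - 1) * (x - b) <= x `^ r - b `^ r.
Proof.
move=> r1 b0 x0.
have mono y z : 0 < y -> y < z -> r * y `^ (r - 1) <= r * z `^ (r - 1).
  move=> y0 yz; have [->|rn1] := eqVneq r 1; first by rewrite subrr !powRr0.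
  have r10 : r - 1 != 0 by rewrite subr_eq0.
  have := ltW (ltr_powR_scaled r10 y0 yz).
  have w0 : 0 <= r * (r - 1) / (r - 1) ^+ 2 by rewrite divr_ge0// sqr_ge0.
  move=> /(ler_wpM2l w0).
  have E t : r * (r - 1) / (r - 1) ^+ 2 * ((r - 1) * t) = r * t by field.
  by rewrite !E.
have [xb|bx|->] := ltgtP x b; last by rewrite !subrr mulr0.
- have [c /andP[xc cb] E] := powR_mean_value r x0 xb.
  rewrite -[x `^ r - _]opprB E -[x - b]opprB mulrN lerN2 ler_pM2r ?subr_gt0//.
  by apply: mono => //; exact: lt_trans xc.
- have [c /andP[bc cx] ->] := powR_mean_value r b0 bx.
  by rewrite ler_pM2r ?subr_gt0// mono.
Qed.

(** Put r = q - 2 >= 1. The terms of [arc_slope] are values of x^r at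
    1 + k s, s and, negatively, 1 - k s, where the positive weights have the
    same total as the negative one. Bounding x^r below by its tangent at
    1 - k s reduces the claim to the case r = 1, where the expression factors
    as 2 s (1 - (k + 1) s) (k - 1 + k^2 s). This is where k >= 1 is used. *)
Lemma arc_slope_ge0 q k s : 3 <= q -> 1 <= k -> 0 < s -> (k + 1) * s <= 1 ->
  0 <= arc_slope q k s.
Proof.
move=> q3 k1 s0 ks1.
have a0 : 0 < 1 + k * s by nra.
have b0 : 0 < 1 - k * s by nra.
rewrite /arc_slope.
rewrite -!(mulr_powRB1_gt0 (q - 1))//.
have -> : q - 1 - 1 = q - 2 by ring.
have r1 : 0 <= (q - 2) * (q - 2 - 1) by rewrite mulr_ge0; lra.
have Ha := powR_tangent r1 b0 a0.
have Hs := powR_tangent r1 b0 s0.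
set A := (1 + k * s) `^ _ in Ha *; set B := (1 - k * s) `^ (q - 2) in Ha Hs *.
set S := s `^ _ in Hs *; set m := _ * _ `^ _ in Ha Hs.
have m0 : 0 <= m by rewrite mulr_ge0 ?powR_ge0//; lra.
have -> : (1 + k * s) * A * (1 - (k + 1) * s)
   - (1 - k * s) * B * (1 + (k + 1) * s) + 2 * (s * S)
   = (1 - (k + 1) * s) * (1 + k * s) * (A - B) + 2 * s * (S - B) by ring.
have w0 : 0 <= (1 - (k + 1) * s) * (1 + k * s).
  by rewrite mulr_ge0 ?subr_ge0// ltW.
have H1 := ler_wpM2l w0 Ha.
have s20 : 0 <= 2 * s by lra.
have H2 := ler_wpM2l s20 Hs.
apply: (le_trans _ (lerD H1 H2)).
have -> : (1 - (k + 1) * s) * (1 + k * s) * (m * (1 + k * s - (1 - k * s)))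
  + 2 * s * (m * (s - (1 - k * s)))
  = 2 * s * m * ((1 - (k + 1) * s) * ((k - 1) + k ^+ 2 * s)) by ring.
have k20 : 0 <= k ^+ 2 * s by rewrite mulr_ge0 ?sqr_ge0// ltW.
apply: mulr_ge0; first by rewrite mulr_ge0.
by rewrite mulr_ge0 ?subr_ge0//; lra.
Qed.

(** With y = exp u this is r sinh (r u) <= r^2 sinh u. *)
Lemma powR_sinh_le r y : - 1 <= r <= 1 -> 1 <= y ->
  r * (y `^ r - y `^ (- r)) <= r ^+ 2 * (y - y^-1).
Proof.
move=> /andP[rm1 r1] y1.
pose f x := r ^+ 2 * (x - x^-1) - r * (x `^ r - x `^ (- r)).
pose df x := r ^+ 2 * (1 + x ^- 2) - r * (r * x `^ (r - 1) + r * x `^ (- r - 1)).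
have fy : f 1 <= f y.
  apply: (@derive_ge0_le f df) y1 _ _ => x /andP[x1 _].
    have x0 : 0 < x by lra.
    have d1 := is_derive1_powR r x0.
    have d2 := is_derive1_powR (- r) x0.
    have d3 : is_derive x 1 (fun z => z^-1) (- x ^- 2 *: 1).
      by apply: (@is_deriveV R id); rewrite ?gt_eqF.
    rewrite /f; apply: is_derive_eq; rewrite /GRing.scale/= /df; ring.
  have x0 : 0 < x by lra.
  have x1' : 1 <= x by lra.
  rewrite /df !powRB ?(gt_eqF x0) ?implybT// powRr1 ?(ltW x0)// powRN.
  have Y0 : 0 < x `^ r by exact: powR_gt0.
  have Yx : x `^ r <= x by exact: ler1_powR.
  have xY : 1 <= x * x `^ r.
    have := mulr_powRB1_gt0 (r + 1) x0; rewrite addrK => ->.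
    by rewrite -[leLHS](powRr0 x) ler_powR//; lra.
  set Y := x `^ r in Y0 Yx xY *.
  have -> : r ^+ 2 * (1 + x ^- 2) - r * (r * (Y / x) + r * (Y^-1 / x))
    = r ^+ 2 * ((x - Y) * (x * Y - 1)) / (x ^+ 2 * Y).
    by field; rewrite !gt_eqF.
  have xY0 : 0 <= x ^+ 2 * Y by rewrite ltW// mulr_gt0// exprn_gt0.
  by rewrite divr_ge0// mulr_ge0 ?sqr_ge0// mulr_ge0// subr_ge0.
move: fy; rewrite /f !powR1 invr1 !subrr !mulr0 subrr subr_ge0 => //.
Qed.

(** With y = exp (2 u) this is r tanh u / tanh (r u). *)
Definition coth_ratio r y : R := r * (1 + 2 * (y `^ r - 1)^-1) * (1 - 2 * (y + 1)^-1).

(** The derivative is a positive factor times the left side minus the right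
    side of [powR_sinh_le]. *)
Lemma coth_ratio_decr r x y : r != 0 -> - 1 <= r <= 1 -> 1 < x -> x <= y ->
  coth_ratio r y <= coth_ratio r x.
Proof.
move=> rn0 r1 x1 xy.
pose df z := 2 * (r * (z `^ r - z `^ (- r)) - r ^+ 2 * (z - z^-1))
    * z `^ r / ((z `^ r - 1) ^+ 2 * (z + 1) ^+ 2).
have pow_neq1 z : 1 < z -> z `^ r - 1 != 0.
  move=> z1; rewrite subr_eq0; apply/eqP => E.
  have := ltr_powR_scaled rn0 ltr01 z1.
  by rewrite powR1 E ltxx.
apply: (@derive_le0_ge (coth_ratio r) df) xy _ _ => z /andP[xz _].
  have z1 : 1 < z by lra.
  have z0 : 0 < z by lra.
  have zr := pow_neq1 _ z1.
  have d1 := is_derive1_powR r z0.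
  have d2 : is_derive z 1 (fun t => t `^ r - 1) (r * z `^ (r - 1)).
    by apply: is_derive_eq; ring.
  have d3 := @is_deriveV R (fun t => t `^ r - 1) _ _ _ zr d2.
  have d4 : is_derive z 1 (fun t => t + 1) 1 by apply: is_derive_eq; rewrite addr0.
  have z10 : z + 1 != 0 by rewrite gt_eqF//; lra.
  have d5 := @is_deriveV R (fun t => t + 1) z _ _ z10 d4.
  rewrite /coth_ratio; apply: is_derive_eq.
  rewrite /GRing.scale/= /df powRB ?(gt_eqF z0) ?implybT// powRr1 ?ltW// powRN.
  have Y0 : z `^ r != 0 by rewrite gt_eqF ?powR_gt0.
  by field; rewrite zr z10 Y0 gt_eqF.
have z1 : 1 < z by lra.
rewrite /df pmulr_lle0; last first.
  by rewrite invr_gt0 mulr_gt0// exprn_even_gt0//= ?pow_neq1// gt_eqF//; lra.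
rewrite pmulr_lle0; last by rewrite powR_gt0//; lra.
by rewrite pmulr_rle0// subr_le0 powR_sinh_le// ltW.
Qed.

(** [arc_slope] in the variable c = 1/s, divided by s^(q-1) and without the
    constant 2. Dividing by this power turns that constant into an additive
    one, which differentiation removes. *)
Definition arc_slope_inv q k c : R :=
  (c + k) `^ (q - 1) * (1 - (k + 1) * c^-1)
  - (c - k) `^ (q - 1) * (1 + (k + 1) * c^-1).

Lemma arc_slopeE q k s : 1 <= k -> 0 < s -> (k + 1) * s <= 1 ->
  arc_slope q k s = s `^ (q - 1) * (arc_slope_inv q k s^-1 + 2).
Proof.
move=> k1 s0 ks1; rewrite /arc_slope /arc_slope_inv invrK.
have c1 : k + 1 <= s^-1 by rewrite -div1r ler_pdivlMr.
have sD : 1 + k * s = s * (s^-1 + k) by field; rewrite gt_eqF.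
have sB : 1 - k * s = s * (s^-1 - k) by field; rewrite gt_eqF.
rewrite sD sB !powRM ?(ltW s0)//; first by ring.
all: lra.
Qed.

(** The derivative of (q - 2) arc_slope_inv is a positive factor times psi,
    and psi is decreasing: so the function increases up to some point and
    decreases afterwards. In psi the quotient (c + k) / (c - k) decreases in c,
    which is why the monotonicity of [coth_ratio] enters. *)
Lemma arc_slope_inv_quasiconcave q k a b c : 1 < q < 3 -> q != 2 -> 1 <= k ->
  k + 1 <= a -> a <= b -> b <= c ->
  Num.min ((q - 2) * arc_slope_inv q k a) ((q - 2) * arc_slope_inv q k c)
    <= (q - 2) * arc_slope_inv q k b.
Proof.
move=> /andP[q1 q3] q2 k1 ka ab bc.
have q20 : q - 2 != 0 by rewrite subr_eq0.
pose psi x := q - 1 + k * (k + 1) / x ^+ 2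
   - (k + 1) / k * coth_ratio (q - 2) ((x + k) / (x - k)).
pose df x := (q - 2) * ((x + k) `^ (q - 2) - (x - k) `^ (q - 2)) * psi x.
have pos x : k + 1 <= x -> 0 < (q - 2) * ((x + k) `^ (q - 2) - (x - k) `^ (q - 2)).
  by move=> kx; rewrite mulrBr subr_gt0 ltr_powR_scaled//; lra.
have psi_decr x y : k + 1 <= x -> x <= y -> psi y <= psi x.
  move=> kx xy.
  have x0 : 0 < x by lra.
  have y0 : 0 < y by lra.
  rewrite /psi lerB// ?lerD2l.
    rewrite ler_wpM2l ?mulr_ge0//; try lra.
    by rewrite lef_pV2 ?posrE ?exprn_gt0// ler_sqr ?nnegrE// ltW.
  rewrite ler_wpM2l ?divr_ge0//; try lra.
  apply: coth_ratio_decr => //; first lra.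
    by rewrite ltr_pdivlMr; lra.
  rewrite ler_pdivrMr; last lra.
  by rewrite mulrAC ler_pdivlMr; nra.
have dJ x : k + 1 <= x -> is_derive x 1 (fun t => (q - 2) * arc_slope_inv q k t) (df x).
  move=> kx.
  have x0 : 0 < x by lra.
  have xk : 0 < x + k by lra.
  have xk' : 0 < x - k by lra.
  have e1 : is_derive x 1 (fun t => t + k) 1 by apply: is_derive_eq; rewrite addr0.
  have e2 : is_derive x 1 (fun t => t - k) 1 by apply: is_derive_eq; rewrite addr0.
  have d1 := @is_derive1_comp R (fun t => t `^ (q - 1)) (fun t => t + k) _ _ _
    (is_derive1_powR (q - 1) xk) e1.
  have d2 := @is_derive1_comp R (fun t => t `^ (q - 1)) (fun t => t - k) _ _ _
    (is_derive1_powR (q - 1) xk') e2.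
  have d3 : is_derive x 1 (fun z => z^-1) (- x ^- 2 *: 1).
    by apply: (@is_deriveV R id); rewrite ?gt_eqF.
  rewrite /arc_slope_inv; apply: is_derive_eq.
  rewrite /GRing.scale/= -!(mulr_powRB1_gt0 (q - 1))//.
  have -> : q - 1 - 1 = q - 2 by ring.
  rewrite /df /psi /coth_ratio.
  have -> : ((x + k) / (x - k)) `^ (q - 2) = (x + k) `^ (q - 2) / (x - k) `^ (q - 2).
    rewrite powRM ?invr_ge0 ?ltW//; congr (_ * _).
    by rewrite -powR_inv1 ?ltW// -powRrM mulN1r powRN.
  have A0 : (x - k) `^ (q - 2) != 0 by rewrite gt_eqF ?powR_gt0.
  have AB : (x + k) `^ (q - 2) - (x - k) `^ (q - 2) != 0.
    by have := pos _ kx; rewrite lt0r mulf_eq0 negb_or => /andP[/andP[]].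
  set A := (x + k) `^ _ in AB *; set B := (x - k) `^ _ in A0 AB *.
  have xk0 : x + k + (x - k) != 0 by rewrite gt_eqF//; lra.
  have AB' : A + -1 * B != 0 by rewrite mulN1r.
  have k0 : 0 < k by lra.
  by field; rewrite xk0 A0 AB' (gt_eqF xk') (gt_eqF k0) (gt_eqF x0).
have [psib|psib] := lerP 0 (psi b).
- rewrite ge_min; apply/orP; left.
  apply: (@derive_ge0_le (fun t => (q - 2) * arc_slope_inv q k t) df)
    ab _ _ => [x xab|x /andP[ax xb]]; first by apply: dJ; lra.
  by rewrite mulr_ge0 ?(ltW (pos _ _))// ?(le_trans psib)// ?psi_decr//; lra.
- rewrite ge_min; apply/orP; right.
  apply: (@derive_le0_ge (fun t => (q - 2) * arc_slope_inv q k t) df)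
    bc _ _ => [x xbc|x /andP[bx xc]]; first by apply: dJ; lra.
  rewrite mulr_ge0_le0 ?(ltW (pos _ _))//; first by lra.
  by rewrite (le_trans _ (ltW psib))// psi_decr//; lra.
Qed.

Lemma arc_slope_inv_end q k : 1 <= k -> arc_slope_inv q k (k + 1) = - 2.
Proof.
move=> k1; rewrite /arc_slope_inv divff ?gt_eqF//; last lra.
have -> : k + 1 - k = 1 by ring.
by rewrite powR1; ring.
Qed.

(** Quasiconcavity between the end c = k + 1, where arc_slope_inv + 2
    vanishes, and c = 1/s, where it is nonnegative up to the factor q - 2. *)
Lemma arc_slope_upclosed q k s t : 1 < q < 3 -> q != 2 -> 1 <= k ->
  0 < s -> s <= t -> (k + 1) * t <= 1 ->
  0 <= (q - 2) * arc_slope q k s -> 0 <= (q - 2) * arc_slope q k t.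
Proof.
move=> q13 q2 k1 s0 st kt1.
have k0 : 0 < k + 1 by lra.
have t0 : 0 < t by exact: lt_le_trans st.
have ks1 : (k + 1) * s <= 1 by rewrite (le_trans _ kt1)// ler_pM2l.
rewrite !arc_slopeE// ![(q - 2) * (_ * _)]mulrCA.
rewrite (pmulr_rge0 _ (powR_gt0 _ s0)) (pmulr_rge0 _ (powR_gt0 _ t0)).
have kt : k + 1 <= t^-1 by rewrite -div1r ler_pdivlMr.
have ts : t^-1 <= s^-1 by rewrite lef_pV2.
have := arc_slope_inv_quasiconcave q13 q2 k1 (lexx _) kt ts.
rewrite arc_slope_inv_end// ge_min => /orP[] Hmin Hs; lra.
Qed.

(** The set of s where (q - 2) arc_slope is nonnegative is closed upwards. If
    it meets ]0, s], then (q - 2) arc_ratio increases from s to the right end;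
    otherwise it decreases from the left end to s. *)
Lemma arc_ratio_le_ends q k s : 1 < q -> q != 2 -> 1 <= k -> 0 <= s <= (k + 1)^-1 ->
  (q - 2) * arc_ratio q k s <= (q - 2) * arc_ratio q k 0 \/
  (q - 2) * arc_ratio q k s <= (q - 2) * arc_ratio q k (k + 1)^-1.
Proof.
move=> q1 q2 k1 /andP[s0 s1]; have k0 : 0 < k + 1 by lra.
have ks1 x : x <= (k + 1)^-1 -> (k + 1) * x <= 1.
  by move=> x1; rewrite mulrC -ler_pdivlMr// div1r.
pose df x := (q - 2) * (2 * q * k *
  (2 + 2 * k * (k + 1) * x ^+ 2) `^ (- (q / 2) - 1) * arc_slope q k x).
have dF x : 0 <= x <= (k + 1)^-1 ->
    is_derive x 1 (fun x => (q - 2) * arc_ratio q k x) (df x).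
  move=> x01; have d1 := is_derive_arc_ratio q1 k1 x01.
  by apply: is_derive_eq; rewrite /GRing.scale/= /df; ring.
have dfE x : exists2 m, 0 <= m & df x = m * ((q - 2) * arc_slope q k x).
  exists (2 * q * k * (2 + 2 * k * (k + 1) * x ^+ 2) `^ (- (q / 2) - 1)).
    by rewrite mulr_ge0 ?powR_ge0// mulr_ge0//; lra.
  by rewrite /df; ring.
have up : (forall x, s < x < (k + 1)^-1 -> 0 <= (q - 2) * arc_slope q k x) ->
    (q - 2) * arc_ratio q k s <= (q - 2) * arc_ratio q k (k + 1)^-1.
  move=> H.
  apply: (@derive_ge0_le (fun t => (q - 2) * arc_ratio q k t) df) s1 _ _ => x xs.
    by apply: dF; move: xs => /andP[sx ->]; rewrite (le_trans s0).
  by have [m m0 ->] := dfE x; rewrite mulr_ge0// H.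
have [q3|q3] := lerP 3 q.
  right; apply: up => x /andP[sx x1].
  have x0 := le_lt_trans s0 sx; have kx1 := ks1 x (ltW x1).
  by rewrite mulr_ge0 ?arc_slope_ge0//; lra.
have q13 : 1 < q < 3 by rewrite q1.
have [[x /andP[x0 xs] Gx]|noG] :=
    pselect (exists2 x, 0 < x <= s & 0 <= (q - 2) * arc_slope q k x).
  right; apply: up => y /andP[sy y1].
  apply: (@arc_slope_upclosed q k x y) => //; last exact/ks1/ltW.
  by rewrite (le_trans xs)// ltW.
left; apply: (@derive_le0_ge (fun t => (q - 2) * arc_ratio q k t) df) s0 _ _;
  move=> x /andP[x0 xs].
  by apply: dF; rewrite x0 (le_trans xs).
have [m m0 ->] := dfE x; rewrite mulr_ge0_le0// leNgt; apply/negP => Gx.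
by apply: noG; exists x; rewrite ?x0 ltW.
Qed.

(** Negating the vector makes the middle value v nonpositive; then with
    c = (a - b) / 2 the vector is c (1 + k s, -s, ..., -s, -(1 - k s)) for
    s = - v / c, and the constraint s <= 1 / (k + 1) is exactly b <= v. *)
Lemma arc_ratio_cover q k a b v : 1 <= k -> b <= v -> v <= a ->
  a + b + 2 * k * v = 0 -> a ^+ 2 + b ^+ 2 + 2 * k * v ^+ 2 = 1 ->
  exists2 s, 0 <= s <= (k + 1)^-1 &
    `|a| `^ q + `|b| `^ q + 2 * k * `|v| `^ q = arc_ratio q k s.
Proof.
move=> k1; wlog v0 : a b v / v <= 0.
  move=> H bv va E0 E1; have [v0|v0] := lerP v 0; first exact: H.
  have [|||||s s01 Es] := H (- b) (- a) (- v).
  - by rewrite oppr_le0 ltW.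
  - by rewrite lerN2.
  - by rewrite lerN2.
  - by move: E0; lra.
  - by rewrite !sqrrN; move: E1; lra.
  by exists s => //; rewrite -Es !normrN (addrC (`|b| `^ q)).
move=> bv va E0 E1; pose c := (a - b) / 2.
have aE : a = c - k * v by move: E0; rewrite /c; lra.
have bE : b = - c - k * v by move: E0; rewrite /c; lra.
have c0 : 0 < c.
  have [//|c0] := ltP 0 c; exfalso.
  have ab : a = b.
    by apply/eqP; rewrite eq_le (le_trans bv va) andbT; move: c0; rewrite /c; lra.
  have vb : v = b by apply/eqP; rewrite eq_le bv andbT -ab.
  have va0 : v = 0.
    have : (2 + 2 * k) * v = 0 by move: E0; rewrite ab vb; lra.
    by move/eqP; rewrite mulf_eq0 => /orP[|/eqP//]; rewrite gt_eqF//; lra.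
  by move: E1; rewrite ab -vb va0; rewrite !expr0n/=; lra.
have k0 : 0 < k + 1 by lra.
exists (- v / c).
  rewrite divr_ge0 ?oppr_ge0 ?(ltW c0)//= ler_pdivrMr// mulrC ler_pdivlMr//.
  by move: bv; rewrite bE; lra.
rewrite /arc_ratio.
have -> : a = c * (1 + k * (- v / c)) by rewrite aE; field; rewrite gt_eqF.
have -> : b = - (c * (1 - k * (- v / c))) by rewrite bE; field; rewrite gt_eqF.
have vE : v = - (c * (- v / c)) by field; rewrite gt_eqF.
rewrite {3}vE; set s := - v / c.
have cM u : `|c * u| `^ q = c `^ q * `|u| `^ q.
  by rewrite normrM powRM// gtr0_norm.
rewrite !normrN !cM.
have N1 : (2 + 2 * k * (k + 1) * s ^+ 2) * c ^+ 2 = 1.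
  by rewrite -[RHS]E1 aE bE [v in RHS]vE -/s; ring.
have -> : 2 + 2 * k * (k + 1) * s ^+ 2 = c `^ (- 2%:R).
  rewrite powR_invn ?(ltW c0)//; apply: (@mulIf _ (c ^+ 2)).
    by rewrite sqrf_eq0 gt_eqF.
  by rewrite N1 mulVf// sqrf_eq0 gt_eqF.
rewrite -powRrM; have -> : - 2%:R * - (q / 2) = q by field.
ring.
Qed.

Lemma arc_ratio0 q k : 1 < q -> arc_ratio q k 0 = 2 `^ (1 - q / 2).
Proof.
move=> q1; rewrite /arc_ratio !mulr0 addr0 subr0 normr0 normr1 !powR1.
rewrite powR0 ?gt_eqF ?(lt_trans _ q1)// expr0n/= !mulr0 !addr0.
by rewrite powRB ?pnatr_eq0 ?implybT// powRr1// powRN.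
Qed.

(** ||x||_q^q / ||x||_2^q for x = (t - 1, -1, ..., -1) in dimension t. *)
Definition spike_value q t : R :=
  ((t - 1) `^ (q / 2) + (t - 1) `^ (1 - q / 2)) / t `^ (q / 2).

Lemma spike_valueE q t : 1 < t ->
  ((t - 1) `^ q + (t - 1)) / (t * (t - 1)) `^ (q / 2) = spike_value q t.
Proof.
move=> t1; have t0 : 0 < t by lra.
have u0 : 0 < t - 1 by lra.
rewrite /spike_value powRM ?(ltW t0) ?(ltW u0)// powRB ?(gt_eqF u0) ?implybT//.
rewrite powRr1 ?(ltW u0)// [in LHS](_ : q = q / 2 + q / 2); last by field.
rewrite powRD ?(gt_eqF u0) ?implybT//.
have -> : (q / 2 + q / 2) / 2 = q / 2 by field.
have A0 : t `^ (q / 2) != 0 by rewrite gt_eqF ?powR_gt0.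
have B0 : (t - 1) `^ (q / 2) != 0 by rewrite gt_eqF ?powR_gt0.
by field; rewrite A0 B0.
Qed.

Lemma arc_ratio_end q k : 1 < q -> 1 <= k ->
  arc_ratio q k (k + 1)^-1 = spike_value q (2 * k + 2).
Proof.
move=> q1 k1; have k0 : 0 < k + 1 by lra.
have t1 : 1 < 2 * k + 2 by lra.
rewrite -spike_valueE//.
have E : 2 * k + 2 - 1 = 2 * k + 1 by ring.
rewrite E /arc_ratio.
have -> : 1 + k * (k + 1)^-1 = (2 * k + 1) * (k + 1)^-1 by field; rewrite gt_eqF.
have -> : 1 - k * (k + 1)^-1 = (k + 1)^-1 by field; rewrite gt_eqF.
have i0 : 0 < (k + 1)^-1 by rewrite invr_gt0.
have n0 : 0 < 2 * k + 1 by lra.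
have -> : 2 + 2 * k * (k + 1) * (k + 1)^-1 ^+ 2
   = (2 * k + 2) * (2 * k + 1) * ((k + 1)^-1 `^ 2).
  rewrite powR_mulrn ?(ltW i0)//; by field; rewrite gt_eqF.
rewrite !ger0_norm ?mulr_ge0 ?(ltW i0) ?(ltW n0)//.
have m0 : 0 <= 2 * k + 2 by lra.
rewrite !powRM ?mulr_ge0 ?powR_ge0 ?(ltW i0) ?(ltW n0)//.
rewrite -powRrM; have -> : 2 * - (q / 2) = - q by field.
rewrite !powRN.
have A0 : (k + 1)^-1 `^ q != 0 by rewrite gt_eqF ?powR_gt0.
have B0 : (2 * k + 1) `^ (q / 2) != 0 by rewrite gt_eqF ?powR_gt0.
have C0 : (2 * k + 2) `^ (q / 2) != 0 by rewrite gt_eqF ?powR_gt0//; lra.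
by field; rewrite A0 B0 C0.
Qed.

End Scalar.

(** * Zero-sum vectors *)

Section Vectors.
Variables (R : realType) (d : nat).
Implicit Types (q r s a b v C M k : R) (x y : 'rV[R]_d) (i j l : 'I_d).

Definition psum q x : R := \sum_(i < d) `|x 0 i| `^ q.
Definition sqsum x : R := \sum_(i < d) x 0 i ^+ 2.

Lemma sum_split2 (F : 'I_d -> R) i j : i != j ->
  \sum_l F l = F i + F j + \sum_(l | (l != i) && (l != j)) F l.
Proof.
by move=> ij; rewrite (bigD1 i)//= (bigD1 j)//= ?addrA// eq_sym.
Qed.

Definition set2_row i j a b (z : 'I_d -> R) : 'rV[R]_d :=
  \row_l (if l == i then a else if l == j then b else z l).

Lemma sum_set2_row (g : R -> R) i j a b (z : 'I_d -> R) : i != j ->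
  \sum_l g (set2_row i j a b z 0 l)
    = g a + g b + \sum_(l | (l != i) && (l != j)) g (z l).
Proof.
move=> ij; rewrite (sum_split2 _ ij) !mxE !eqxx eq_sym (negbTE ij).
congr (_ + _); apply: eq_bigr => l /andP[li lj].
by rewrite mxE (negbTE li) (negbTE lj).
Qed.

(** The multiplicity d - 2 is written 2 * ((d - 2) / 2) because the arc is
    parametrised by k = (d - 2) / 2. *)
Lemma sum_set2_row_cst (g : R -> R) i j a b v : (2 <= d)%N -> i != j ->
  \sum_l g (set2_row i j a b (fun=> v) 0 l)
    = g a + g b + 2 * ((d%:R - 2) / 2) * g v.
Proof.
move=> d2 ij; rewrite sum_set2_row//; congr (_ + _).
rewrite big_const_seq iter_addr_0.
have := sum_split2 (fun=> 1) ij.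
rewrite sumr_const card_ord [X in _ = _ + X]big_const_seq iter_addr_0.
by move=> E; rewrite -[g v *+ _]mulr_natl E; field.
Qed.

Lemma sqsum_ge0 x : 0 <= sqsum x.
Proof. by apply: sumr_ge0 => i _; exact: sqr_ge0. Qed.

Lemma sqsum_eq0 x : sqsum x = 0 -> x = 0.
Proof.
move=> /eqP; rewrite psumr_eq0 => [/allP H|i _]; last exact: sqr_ge0.
apply/rowP => i; rewrite mxE; apply/eqP.
by have := H i (mem_index_enum _); rewrite /= sqrf_eq0.
Qed.

Lemma psumZ q a x : 0 <= a -> psum q (a *: x) = a `^ q * psum q x.
Proof.
move=> a0; rewrite /psum mulr_sumr; apply: eq_bigr => i _.
by rewrite mxE normrM ger0_norm// powRM.
Qed.

Lemma sqsumZ a x : sqsum (a *: x) = a ^+ 2 * sqsum x.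
Proof.
by rewrite /sqsum mulr_sumr; apply: eq_bigr => i _; rewrite mxE exprMn.
Qed.

Definition zero_sum_sphere : set 'rV[R]_d :=
  [set x : 'rV[R]_d | \sum_(i < d) x 0 i = 0 /\ sqsum x = 1].

Lemma continuous_sum_coord (f : R -> R) : continuous f ->
  continuous (fun x => \sum_(i < d) f (x 0 i)).
Proof.
move=> cf; apply: continuous_big => [|i _ x]; first exact: add_continuous.
exact: (@continuous_comp _ _ _ (fun x => x 0 i) f x (@coord_continuous _ _ _ 0 i x)
  (cf _)).
Qed.

Lemma compact_zero_sum_sphere : compact zero_sum_sphere.
Proof.
pose box := [set x : 'rV[R]_d | forall i, `[(-1 : R), 1]%classic (x ord0 i)].
have cbox : compact box.
  apply: (@rV_compact _ _ (fun=> `[(-1 : R), 1]%classic)) => i.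
  exact: segment_compact.
apply: (subclosed_compact _ cbox).
- have -> : zero_sum_sphere = ((fun x => \sum_(i < d) x 0 i) @^-1` [set 0])
     `&` (sqsum @^-1` [set 1]) by [].
  apply: closedI; apply: preimage_closed; try exact: closed_eq.
    by move=> x _; apply: (@continuous_sum_coord id) => y; exact: cvg_id.
  move=> x _.
  exact: (@continuous_sum_coord (fun t : R => t ^+ 2) (@exprn_continuous R 2)).
- move=> x [_ x1] i /=; rewrite in_itv/= -ler_norml -(@ler_pXn2r _ 2)// ?nnegrE//.
  rewrite expr1n -x1 /sqsum (bigD1 i)//= real_normK ?num_real// lerDl.
  by apply: sumr_ge0 => j _; exact: sqr_ge0.
Qed.

Lemma continuous_psum q : 1 < q -> continuous (psum q).
Proof.
move=> q1; apply: (@continuous_sum_coord (fun t => `|t| `^ q)) => t.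
apply: differentiable_continuous; apply/derivable1_diffP.
by have [] := is_derive_abspow t q1.
Qed.

(** A maximiser on the compact zero-sum sphere, with the inequality already
    extended to all zero-sum vectors by homogeneity. *)
Lemma extremal_exists q : 1 < q -> (2 <= d)%N ->
  exists2 x, zero_sum_sphere x &
    forall y, \sum_(i < d) y 0 i = 0 ->
      (q - 2) * psum q y <= (q - 2) * (psum q x * sqsum y `^ (q / 2)).
Proof.
move=> q1 d2; have q0 : 0 < q by exact: lt_trans q1.
have normalise y : \sum_(i < d) y 0 i = 0 -> 0 < sqsum y ->
    zero_sum_sphere (sqsum y `^ (- 2^-1) *: y).
  move=> y0 ny; split.
    by under eq_bigr do rewrite mxE; rewrite -mulr_sumr y0 mulr0.
  rewrite sqsumZ -powR_mulrn ?powR_ge0// -powRrM mulNr mulVf// powR_inv1 ?ltW//.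
  by rewrite mulVf// gt_eqF.
have [x xK xmax] : exists2 x, x \in zero_sum_sphere &
    forall y, y \in zero_sum_sphere -> (q - 2) * psum q y <= (q - 2) * psum q x.
  apply: (@EVT_max_rV _ _ (fun x => (q - 2) * psum q x)).
  - pose i0 := Ordinal (ltnW d2); pose j0 := Ordinal d2.
    have ij : i0 != j0 by [].
    exists (sqsum (set2_row i0 j0 1 (- 1) (fun=> 0)) `^ (- 2^-1)
      *: set2_row i0 j0 1 (- 1) (fun=> 0)).
    apply: normalise.
      by rewrite (@sum_set2_row_cst id)// mulr0 addr0 subrr.
    rewrite /sqsum (@sum_set2_row_cst (fun t => t ^+ 2))// expr0n/= mulr0 addr0.
    by rewrite sqrrN expr1n; lra.
  - exact: compact_zero_sum_sphere.
  - apply: continuous_subspaceT => x.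
    have cc : {for x, continuous (fun _ : 'rV[R]_d => q - 2)} by exact: cst_continuous.
    exact: (continuousM cc (@continuous_psum q q1 x)).
exists x; first by move: xK; rewrite inE.
move=> y y0; have := sqsum_ge0 y; rewrite le_eqVlt => /predU1P[ny|ny].
  have p0 : psum q y = 0.
    apply: big1 => i _.
    by rewrite (sqsum_eq0 (esym ny)) mxE normr0 powR0// gt_eqF.
  by rewrite p0 -ny powR0 ?mulr0// gt_eqF// divr_gt0.
have := xmax _ (mem_set (normalise _ y0 ny)).
rewrite psumZ ?powR_ge0// -powRrM => H.
have Nq : 0 < sqsum y `^ (q / 2) by exact: powR_gt0.
rewrite -(ler_pM2l Nq) in H.
have E : sqsum y `^ (q / 2) * sqsum y `^ (- 2^-1 * q) = 1.
  rewrite -powRD ?(gt_eqF ny) ?implybT//.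
  have -> : q / 2 + - 2^-1 * q = 0 by ring.
  by rewrite powRr0.
move: H; rewrite mulrCA (mulrA (sqsum y `^ (q / 2))) E mul1r => /le_trans; apply.
by rewrite mulrCA [psum q x * _]mulrC.
Qed.

(** Let i and j be the indices of a largest and a smallest coordinate. A
    coordinate x_l strictly between these two is in the middle zone: by
    [tilt_outer] applied to x_l and x_i if x_l > 0, to - x_l and - x_j if
    x_l < 0. A coordinate equal to one of them is a repeated value, so it is
    in the middle zone by [repeated_coord]. There [tilt] is injective, so
    all these coordinates agree. *)
Lemma extremal_shape q x : 1 < q -> q != 2 -> (4 <= d)%N -> zero_sum_sphere x ->
  (forall y, \sum_(i < d) y 0 i = 0 ->
      (q - 2) * psum q y <= (q - 2) * (psum q x * sqsum y `^ (q / 2))) ->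
  exists i j v, [/\ i != j, x 0 j <= v, v <= x 0 i
    & x = set2_row i j (x 0 i) (x 0 j) (fun=> v)].
Proof.
move=> q1 q2 d4 [x0 x1] xmax; set C := psum q x in xmax.
have pair i j e : i != j ->
   (q - 2) * (`|x 0 i + e| `^ q + `|x 0 j - e| `^ q
               - C * (1 + 2 * e * (x 0 i - x 0 j) + 2 * e ^+ 2) `^ (q / 2))
     <= (q - 2) * (`|x 0 i| `^ q + `|x 0 j| `^ q - C).
  move=> ij; have := xmax (set2_row i j (x 0 i + e) (x 0 j - e) (x 0)).
  rewrite (@sum_set2_row id)// /psum /sqsum (@sum_set2_row (fun t => t ^+ 2))//.
  rewrite (@sum_set2_row (fun t => `|t| `^ q))//.
  have := sum_split2 (fun l => x 0 l) ij; rewrite x0 => E0.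
  have := sum_split2 (fun l => x 0 l ^+ 2) ij; rewrite -/(sqsum x) x1 => E1.
  have := sum_split2 (fun l => `|x 0 l| `^ q) ij; rewrite -/(psum q x) -/C => EC.
  have -> : x 0 i + e + (x 0 j - e) + \sum_(l | (l != i) && (l != j)) x 0 l = 0.
    by rewrite [RHS]E0; ring.
  move=> /(_ erefl).
  have -> : (x 0 i + e) ^+ 2 + (x 0 j - e) ^+ 2
      + \sum_(l | (l != i) && (l != j)) x 0 l ^+ 2
     = 1 + 2 * e * (x 0 i - x 0 j) + 2 * e ^+ 2.
    by move: E1; set S := \sum_(l | _) _ => E1; lra.
  move: EC; set S := \sum_(l | _) _; set W := _ `^ (q / 2) => EC.
  have -> : S = C - `|x 0 i| `^ q - `|x 0 j| `^ q by rewrite EC; ring.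
  lra.
have tiltx i j : tilt q C (x 0 i) = tilt q C (x 0 j).
  have [->//|ij] := eqVneq i j.
  by apply: tilt_eq => // e; exact: pair.
(* Middle zone, for t > 0; negative coordinates are covered by inner (- t). *)
pose inner t := 0 < t -> (q - 2) * ((q - 1) * t `^ (q - 2) - C) <= 0.
have repeat i j : i != j -> x 0 i = x 0 j -> inner (x 0 i) /\ inner (- x 0 i).
  move=> ij E; split=> t0; apply: repeated_coord => // e.
    have := pair i j e ij; rewrite -E subrr mulr0 addr0; exact.
  have := pair i j e ij; rewrite -E subrr mulr0 addr0.
  have -> : `|- x 0 i + e| = `|x 0 i - e| by rewrite -normrN opprD opprK.
  have -> : `|- x 0 i - e| = `|x 0 i + e| by rewrite -opprD normrN.
  by rewrite normrN (addrC (`|x 0 i - e| `^ q)).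
have tiltN t : tilt q C (- t) = - tilt q C t by rewrite /tilt spowN; ring.
pose l0 : 'I_d := Ordinal (leq_trans (isT : (0 < 4)%N) d4).
have [i imax] : exists i, forall l, x 0 l <= x 0 i.
  case: (@Order.TotalTheory.arg_maxP _ _ _ l0 xpredT (fun l => x 0 l)) => // i _ H.
  by exists i => l; exact: H.
have [j jmin] : exists j, forall l, x 0 j <= x 0 l.
  case: (@Order.TotalTheory.arg_minP _ _ _ l0 xpredT (fun l => x 0 l)) => // j _ H.
  by exists j => l; exact: H.
have ij : i != j.
  apply/eqP => ij; have cst l : x 0 l = x 0 i.
    by apply/eqP; rewrite eq_le imax ij jmin.
  have xi0 : x 0 i = 0.
    move: x0; under eq_bigr do rewrite cst.
    rewrite sumr_const card_ord => /eqP; rewrite mulrn_eq0 => /orP[|/eqP//].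
    by move=> /eqP d0; move: (ltn_ord l0); rewrite {2}d0.
  move: x1; rewrite /sqsum big1 => [/eqP|l _]; first by rewrite eq_sym oner_eq0.
  by rewrite cst xi0 expr0n.
have mid l : l != i -> l != j -> inner (x 0 l) /\ inner (- x 0 l).
  move=> li lj; have [E|nE] := eqVneq (x 0 l) (x 0 i); first exact: (repeat l i).
  have [E|nE'] := eqVneq (x 0 l) (x 0 j); first exact: (repeat l j).
  split=> t0.
    have lt_li : x 0 l < x 0 i by rewrite lt_neqAle nE imax.
    by have := tilt_outer q1 q2 t0 lt_li (tiltx i l); lra.
  have lt_lj : - x 0 l < - x 0 j by rewrite ltrN2 lt_neqAle eq_sym nE' jmin.
  have E : tilt q C (- x 0 j) = tilt q C (- x 0 l) by rewrite !tiltN (tiltx j l).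
  by have := tilt_outer q1 q2 t0 lt_lj E; lra.
have mid_eq l m : l != i -> l != j -> m != i -> m != j -> x 0 l = x 0 m.
  wlog lm : l m / x 0 l < x 0 m.
    move=> H li lj mi mj; have [lm|lm|//] := ltgtP (x 0 l) (x 0 m).
      exact: H.
    exact/esym/H.
  move=> li lj mi mj; exfalso.
  have [il inl] := mid _ li lj; have [im inm] := mid _ mi mj.
  have [m0|m0] := ltP 0 (x 0 m).
    have := tilt_inner_neq q1 q2 lm m0 (im m0); rewrite (tiltx m l) eqxx.
    move=> /(_ _)/negP; apply => //.
    by move=> l0'; apply: inl; rewrite oppr_gt0.
  have nl0 : 0 < - x 0 l by rewrite oppr_gt0 (lt_le_trans lm).
  have lm' : - x 0 m < - x 0 l by rewrite ltrN2.
  have := tilt_inner_neq q1 q2 lm' nl0 (inl nl0).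
  rewrite !tiltN (tiltx m l) eqxx => /(_ _)/negP; apply => //.
  by rewrite oppr_lt0 => /(le_lt_trans m0); rewrite ltxx.
have [m mi mj] : exists2 m, m != i & m != j.
  have : (0 < #|~: [set i; j]|)%N.
    by have := cardsC [set i; j]; rewrite cards2 card_ord ij; lia.
  by case/card_gt0P => m; rewrite !inE negb_or => /andP[]; exists m.
exists i, j, (x 0 m); split => //.
apply/rowP => l; rewrite mxE.
have [->//|li] := eqVneq l i; have [->//|lj] := eqVneq l j.
exact: mid_eq.
Qed.

End Vectors.

(** * The extremal values *)

Section Values.
Variables (R : realType) (d : nat).
Implicit Types (q M : R) (x y : 'rV[R]_d).

(** The extremal vector lies on the arc, so its value is bounded by the value at
    one of the two ends, on the side determined by the sign of q - 2. *)
Lemma psum_extremal q : 1 < q -> q != 2 -> (4 <= d)%N ->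
  exists2 M, M = 2 `^ (1 - q / 2) \/ M = spike_value q d%:R &
    forall x, \sum_(i < d) x 0 i = 0 ->
      (q - 2) * psum q x <= (q - 2) * (M * sqsum x `^ (q / 2)).
Proof.
move=> q1 q2 d4; have d2 : (2 <= d)%N by exact: leq_trans d4.
have [x xK xmax] := extremal_exists q1 d2.
have [i [j [v [ij jv vi xE]]]] := extremal_shape q1 q2 d4 xK xmax.
pose k : R := (d%:R - 2) / 2.
have k1 : 1 <= k.
  by rewrite /k; have : (4 : R) <= d%:R by [rewrite ler_nat]; lra.
move: xK => [x0 x1].
have E0 : x 0 i + x 0 j + 2 * k * v = 0.
  by rewrite -x0 [in RHS]xE (@sum_set2_row_cst _ _ id).
have E1 : x 0 i ^+ 2 + x 0 j ^+ 2 + 2 * k * v ^+ 2 = 1.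
  by rewrite -[RHS]x1 /sqsum [in RHS]xE (@sum_set2_row_cst _ _ (fun t => t ^+ 2)).
have Eq : `|x 0 i| `^ q + `|x 0 j| `^ q + 2 * k * `|v| `^ q = psum q x.
  by rewrite /psum [in RHS]xE (@sum_set2_row_cst _ _ (fun t => `|t| `^ q)).
have [s s01 Es] := arc_ratio_cover q k1 jv vi E0 E1.
have dE : 2 * k + 2 = d%:R by rewrite /k; field.
have bound M : (q - 2) * arc_ratio q k s <= (q - 2) * M -> forall x,
    \sum_(i < d) x 0 i = 0 ->
    (q - 2) * psum q x <= (q - 2) * (M * sqsum x `^ (q / 2)).
  move=> H y y0; apply: le_trans (xmax y y0) _.
  by rewrite !mulrA ler_wpM2r ?powR_ge0// -Eq Es.
have [H|H] := arc_ratio_le_ends q1 q2 k1 s01.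
- by exists (arc_ratio q k 0); [left; exact: arc_ratio0|exact: bound].
- exists (arc_ratio q k (k + 1)^-1); last exact: bound.
  by right; rewrite arc_ratio_end// dE.
Qed.

Definition ratio q x : R := lpnorm q x / lpnorm 2 x.

Lemma ratioE q x : 0 < q -> x != 0 ->
  ratio q x = (psum q x / sqsum x `^ (q / 2)) `^ q^-1.
Proof.
move=> q0 xn0; rewrite /ratio /lpnorm.
have N0 : 0 < sqsum x.
  rewrite lt_neqAle sqsum_ge0 andbT eq_sym; apply: contra_neq xn0.
  exact: sqsum_eq0.
have -> : \sum_(i < d) `|x 0 i| `^ 2 = sqsum x.
  apply: eq_bigr => i _.
  by rewrite powR_mulrn// real_normK// num_real.
have P0 : 0 <= psum q x by apply: sumr_ge0 => i _; exact: powR_ge0.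
have E : (sqsum x `^ (q / 2))^-1 `^ q^-1 = (sqsum x `^ 2^-1)^-1.
  rewrite -!powRN -powRrM; congr (_ `^ _).
  by field; rewrite gt_eqF.
by rewrite powRM ?invr_ge0 ?powR_ge0// E.
Qed.

Lemma two_valueE q : 0 < q -> (2 `^ (1 - q / 2)) `^ q^-1 = 2 `^ (q^-1 - 2^-1) :> R.
Proof. by move=> q0; rewrite -powRrM; congr (_ `^ _); field; rewrite gt_eqF. Qed.

Lemma set2_row_neq0 i j a b v : i != j -> a != 0 ->
  set2_row i j a b (fun=> v) != 0 :> 'rV[R]_d.
Proof.
move=> ij; apply: contra_neq => /rowP/(_ i); by rewrite !mxE eqxx.
Qed.

Lemma two_value_attained q : 0 < q -> (2 <= d)%N ->
  zero_sum_ratios d q (2 `^ (q^-1 - 2^-1) : R).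
Proof.
move=> q0 d2; pose i := Ordinal (ltnW d2); pose j := Ordinal d2.
have ij : i != j by [].
have xn0 : set2_row i j 1 (- 1) (fun=> 0) != 0 :> 'rV[R]_d.
  by rewrite set2_row_neq0// oner_eq0.
exists (set2_row i j 1 (- 1) (fun=> 0)).
  split=> //; by rewrite (@sum_set2_row_cst _ _ id)// mulr0 addr0 subrr.
rewrite -/(ratio q _) ratioE// -two_valueE//; congr (_ `^ _).
rewrite /psum /sqsum (@sum_set2_row_cst _ _ (fun t => t ^+ 2))//.
rewrite (@sum_set2_row_cst _ _ (fun t => `|t| `^ q))//.
rewrite normrN normr1 powR1 normr0 powR0 ?gt_eqF// expr0n/= !mulr0 !addr0.
rewrite sqrrN expr1n powRB ?pnatr_eq0 ?implybT// powRr1//.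
Qed.

Lemma spike_value_attained q : 0 < q -> (2 <= d)%N ->
  zero_sum_ratios d q (spike_value q d%:R `^ q^-1).
Proof.
move=> q0 d2; pose i := Ordinal (ltnW d2); pose j := Ordinal d2.
have ij : i != j by [].
have d2R : (2 : R) <= d%:R by rewrite ler_nat.
have xn0 : set2_row i j (d%:R - 1) (- 1) (fun=> - 1) != 0 :> 'rV[R]_d.
  by rewrite set2_row_neq0// gt_eqF//; lra.
exists (set2_row i j (d%:R - 1) (- 1) (fun=> - 1)).
  by split=> //; rewrite (@sum_set2_row_cst _ _ id)//; field.
have d1 : 1 < d%:R :> R by lra.
rewrite -/(ratio q _).
rewrite (ratioE q0 xn0).
rewrite -(spike_valueE q d1).
congr (_ `^ _); rewrite /psum /sqsum (@sum_set2_row_cst _ _ (fun t => t ^+ 2))//.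
rewrite (@sum_set2_row_cst _ _ (fun t => `|t| `^ q))//.
rewrite normrN normr1 powR1 ger0_norm; last lra.
congr (_ / _ `^ _); by field.
Qed.

Lemma sqsum_gt0 x : x != 0 -> 0 < sqsum x.
Proof.
move=> xn0; rewrite lt_neqAle sqsum_ge0 andbT eq_sym.
by apply: contra_neq xn0; exact: sqsum_eq0.
Qed.

Lemma psum_ge0 q x : 0 <= psum q x.
Proof. by apply: sumr_ge0 => i _; exact: powR_ge0. Qed.

Lemma ratio_le q M x : 0 < q -> x != 0 -> 0 <= M ->
  psum q x <= M * sqsum x `^ (q / 2) -> ratio q x <= M `^ q^-1.
Proof.
move=> q0 xn0 M0 H; rewrite ratioE//.
have N0 : 0 < sqsum x `^ (q / 2) by rewrite powR_gt0 ?sqsum_gt0.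
apply: ge0_ler_powR; rewrite ?nnegrE ?invr_ge0 ?(ltW q0)//.
  by rewrite divr_ge0 ?psum_ge0 ?powR_ge0.
by rewrite ler_pdivrMr.
Qed.

Lemma ratio_ge q M x : 0 < q -> x != 0 -> 0 <= M ->
  M * sqsum x `^ (q / 2) <= psum q x -> M `^ q^-1 <= ratio q x.
Proof.
move=> q0 xn0 M0 H; rewrite ratioE//.
have N0 : 0 < sqsum x `^ (q / 2) by rewrite powR_gt0 ?sqsum_gt0.
apply: ge0_ler_powR; rewrite ?nnegrE ?invr_ge0 ?(ltW q0)//.
  by rewrite divr_ge0 ?psum_ge0 ?powR_ge0.
by rewrite ler_pdivlMr.
Qed.

(** In a zero-sum vector each |x_i| is at most the sum of the others, hence at
    most half of the l_1 norm L; so sum x_i^2 <= L/2 sum |x_i|. *)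
Lemma sqsum_le_l1 x : \sum_(i < d) x 0 i = 0 ->
  2 * sqsum x <= (\sum_(i < d) `|x 0 i|) ^+ 2.
Proof.
move=> x0; set L := \sum_(i < d) `|x 0 i|.
have half i : 2 * `|x 0 i| <= L.
  have xi : x 0 i = - \sum_(j | j != i) x 0 j.
    by apply/eqP; rewrite -addr_eq0; move: x0; rewrite (bigD1 i)//= => ->.
  have Li : L = `|x 0 i| + \sum_(j | j != i) `|x 0 j| by rewrite /L (bigD1 i).
  suff : `|x 0 i| <= \sum_(j | j != i) `|x 0 j| by rewrite Li; lra.
  by rewrite [in leLHS]xi normrN ler_norm_sum.
rewrite /sqsum mulr_sumr expr2 [leRHS]mulr_sumr; apply: ler_sum => i _.
rewrite -(@real_normK _ (x 0 i)) ?num_real// expr2 mulrA.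
by rewrite ler_wpM2r.
Qed.

(** The tangent to the convex function t^(q-1) at m, multiplied by t, bounds
    t^q below by a combination of t and t^2, which the constraints control. *)
Lemma psum_ge_le1 q x : 0 < q -> q <= 1 -> \sum_(i < d) x 0 i = 0 -> x != 0 ->
  2 `^ (1 - q / 2) * sqsum x `^ (q / 2) <= psum q x.
Proof.
move=> q0 q1 x0 xn0; have N0 := sqsum_gt0 xn0.
pose m := (sqsum x / 2) `^ 2^-1.
have h0 : 0 < sqsum x / 2 by rewrite divr_gt0.
have m0 : 0 < m by exact: powR_gt0.
have NE : sqsum x = 2 * m ^+ 2.
  rewrite -powR_mulrn ?(ltW m0)// /m -powRrM mulVf// powRr1 ?(ltW h0)//.
  by rewrite mulrC divfK.
have LE : 2 * m <= \sum_(i < d) `|x 0 i|.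
  rewrite -(@ler_pXn2r _ 2)// ?nnegrE ?sumr_ge0//; last lra.
  by apply: le_trans (sqsum_le_l1 x0); rewrite NE exprMn; lra.
have mq : m * m `^ (q - 1) = m `^ q by exact: mulr_powRB1_gt0.
have mq2 : m * m `^ (q - 1 - 1) = m `^ (q - 1) by exact: mulr_powRB1_gt0.
have line t : (2 - q) * m `^ (q - 1) * `|t| - (1 - q) * m `^ (q - 1 - 1) * t ^+ 2
    <= `|t| `^ q.
  rewrite -(@real_normK _ t) ?num_real//; have := normr_ge0 t.
  rewrite le_eqVlt => /predU1P[<-|t0].
    by rewrite expr0n/= !mulr0 subrr powR_ge0.
  rewrite -(mulr_powRB1_gt0 q t0).
  have c : 0 <= (q - 1) * (q - 1 - 1) by rewrite mulr_le0; lra.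
  have := ler_wpM2l (ltW t0) (powR_tangent c m0 t0).
  by rewrite -mq2; lra.
have -> : 2 `^ (1 - q / 2) * sqsum x `^ (q / 2) = 2 * m `^ q.
  rewrite powRB ?pnatr_eq0 ?implybT// powRr1// NE powRM// ?sqr_ge0//.
  rewrite -(powR_mulrn 2 (ltW m0)) -powRrM.
  have -> : 2%:R * (q / 2) = q by field.
  by field; rewrite gt_eqF ?powR_gt0.
have S : \sum_(i < d) ((2 - q) * m `^ (q - 1) * `|x 0 i|
    - (1 - q) * m `^ (q - 1 - 1) * x 0 i ^+ 2) <= psum q x.
  by apply: ler_sum => i _; exact: line.
apply: le_trans S; rewrite sumrB -!mulr_sumr -/(sqsum x) NE.
have c0 : 0 <= (2 - q) * m `^ (q - 1) by rewrite mulr_ge0 ?powR_ge0//; lra.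
have := ler_wpM2l c0 LE; rewrite -mq -mq2; lra.
Qed.

End Values.

Theorem theorem2 (R : realType) (d : nat) (p q : R) (hd : (4 <= d)%N)
    (hp0 : 0 < p) (hp2 : p < 2) (hq : 2 < q) :
  [/\ p <= 1 ->
        is_min (zero_sum_ratios d p) (2 `^ (p^-1 - 2^-1)),
      1 < p ->
        is_min (zero_sum_ratios d p)
          (Num.min (2 `^ (p^-1 - 2^-1))
            ((((d%:R - 1) `^ (p / 2) + (d%:R - 1) `^ (1 - p / 2))
              / d%:R `^ (p / 2)) `^ p^-1))
    & is_max (zero_sum_ratios d q)
        (Num.max (2 `^ (q^-1 - 2^-1))
          ((((d%:R - 1) `^ (q / 2) + (d%:R - 1) `^ (1 - q / 2))
            / d%:R `^ (q / 2)) `^ q^-1))].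
Proof.
have d2 : (2 <= d)%N by exact: leq_trans hd.
have q0 : 0 < q by lra.
have spike_ge0 s : 0 <= spike_value s (d%:R : R).
  by rewrite divr_ge0 ?addr_ge0 ?powR_ge0.
split=> [p1|p1|]; rewrite -?/(spike_value _ _).
- split; first exact: two_value_attained.
  move=> _ [x [xn0 x0] <-]; rewrite -two_valueE//.
  by apply: ratio_ge => //; exact: psum_ge_le1.
- have pn2 : p != 2 by rewrite lt_eqF.
  have [M ME Mmin] := psum_extremal p1 pn2 hd.
  split.
    rewrite /Num.min; case: ifP => _; first exact: two_value_attained.
    exact: spike_value_attained.
  move=> _ [x [xn0 x0] <-].
  have H : M * sqsum x `^ (p / 2) <= psum p x.
    by rewrite -(@ler_nM2l _ (p - 2)) ?subr_lt0// Mmin.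
  rewrite ge_min -two_valueE//; apply/orP.
  case: ME => ME; [left|right]; rewrite -ME;
    by apply: ratio_ge; rewrite // ME ?powR_ge0.
- have qn2 : q != 2 by rewrite gt_eqF.
  have q1 : 1 < q by lra.
  have [M ME Mmax] := psum_extremal q1 qn2 hd.
  split.
    rewrite /Num.max; case: ifP => _; first exact: spike_value_attained.
    exact: two_value_attained.
  move=> _ [x [xn0 x0] <-].
  have H : psum q x <= M * sqsum x `^ (q / 2).
    by rewrite -(@ler_pM2l _ (q - 2)) ?subr_gt0// Mmax.
  rewrite le_max -two_valueE//; apply/orP.
  case: ME => ME; [left|right]; rewrite -ME;
    by apply: ratio_le; rewrite // ME ?powR_ge0.
Qed.
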